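(* Let $n\ge 3$ and let $\alpha:I\to E^n$ be a smooth unit speed curve with Frenet frame $\{V_1,\dots,V_n\}$, whose curvatures $k_1,\dots,k_{n-1}$ vanish nowhere on $I$, and let $H_1^*,\dots,H_{n-2}^*$ be the harmonic curvature functions of $\alpha$ (in the $V_n$-slant helix sense). Then $\alpha$ is a $V_n$-slant helix if and only if the function $\sum_{i=1}^{n-2}(H_i^* )^2$ is constant on $I$ and $H_{n-2}^*$ is not identically zero on $I$.
   Context: $E^n$ is $\mathbb{R}^n$ with the standard inner product $\langle\cdot,\cdot\rangle$, $I\subset\mathbb{R}$ is an open interval, and $s\in I$ is the arc-length parameter; a prime denotes $d/ds$. Frenet frame: $V_1=\alpha'$, $\{V_1,\dots,V_n\}$ is a smooth orthonormal frame along $\alpha$, and the curvature functions $k_1,\dots,k_{n-1}:I\to\mathbb{R}$ satisfy the Frenet formulas $V_1'=k_1V_2$, $V_i'=-k_{i-1}V_{i-1}+k_iV_{i+1}$ for $2\le i\le n-1$, and $V_n'=-k_{n-1}V_{n-1}$. $V_n$-slant helix: $\alpha$ is called a $V_n$-slant helix if there exist a constant unit vector $X\in E^n$ and a constant angle $\varphi\neq\frac{\pi}{2}$ such that $\langle V_n(s),X\rangle=\cos\varphi$ for all $s\in I$. Harmonic curvatures (in the $V_n$-slant helix sense): $H_i^*:I\to\mathbb{R}$, $0\le i\le n-2$, are defined by $H_0^*=0$, $H_1^*=\frac{k_{n-1}}{k_{n-2}}$, and $H_i^*=\frac{1}{k_{n-(i+1)}}\left(k_{n-i}H_{i-2}^*-(H_{i-1}^*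 )'\right)$ for $2\le i\le n-2$. *)

(* Defs.v *)
From HB Require Import structures.
From mathcomp Require Import all_boot all_order all_algebra.
From mathcomp Require Import all_classical all_reals all_analysis.
Set Implicit Arguments.
Unset Strict Implicit.
Unset Printing Implicit Defensive.
Import Order.TTheory GRing.Theory Num.Theory.
Import numFieldNormedType.Exports.
Local Open Scope classical_set_scope.
Local Open Scope ring_scope.

(* The norm `|u| on 'rV[R]_n is the sup norm, so Euclidean lengths are always
   expressed through this inner product. *)
Definition dot (R : realType) (n : nat) (u v : 'rV[R]_n) : R :=
  \sum_(i < n) u 0 i * v 0 i.

Definition open_interval (R : realType) (I : set R) : Prop :=
  [/\ open I, is_interval I & I !=set0].

(* Functions on the open interval I are represented by total functions on R;
   since I is open, their derivatives at points of I only depend on their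
   values on I. *)
Definition smooth_on (R : realType) (U : normedModType R) (I : set R)
    (f : R -> U) : Prop :=
  forall (m : nat) (s : R), I s -> derivable (derive1n m f) s 1.

Definition unit_speed (R : realType) (n : nat) (I : set R)
    (alpha : R -> 'rV[R]_n) : Prop :=
  forall s, I s -> dot (derive1 alpha s) (derive1 alpha s) = 1.

(* Vectors V i (1 <= i <= n) and curvatures k i (1 <= i <= n - 1) are indexed
   from 1; the values of V and k at other indices are irrelevant. *)
Record frenet_frame (R : realType) (n : nat) (I : set R)
    (alpha : R -> 'rV[R]_n) (V : nat -> R -> 'rV[R]_n) (k : nat -> R -> R)
    : Prop := FrenetFrame {
  frenet_tangent : forall s, I s -> V 1%N s = derive1 alpha s;
  frenet_smooth : forall i, (1 <= i <= n)%N -> smooth_on I (V i);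
  frenet_orthonormal : forall i j s, (1 <= i <= n)%N -> (1 <= j <= n)%N ->
    I s -> dot (V i s) (V j s) = (i == j)%:R;
  frenet_first : forall s, I s -> derive1 (V 1%N) s = k 1%N s *: V 2%N s;
  frenet_mid : forall i s, (2 <= i <= n - 1)%N -> I s ->
    derive1 (V i) s = - k (i - 1)%N s *: V (i - 1)%N s + k i s *: V (i + 1)%N s;
  frenet_last : forall s, I s ->
    derive1 (V n) s = - k (n - 1)%N s *: V (n - 1)%N s
}.

(* As the angle between two vectors, phi ranges over [0, pi]. *)
Definition Vn_slant_helix (R : realType) (n : nat) (I : set R)
    (V : nat -> R -> 'rV[R]_n) : Prop :=
  exists (X : 'rV[R]_n) (phi : R),
    [/\ dot X X = 1, 0 <= phi <= pi, phi != pi / 2 &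
        forall s, I s -> dot (V n s) X = cos phi].

Fixpoint harmonic_curvature (R : realType) (n : nat) (k : nat -> R -> R)
    (i : nat) : R -> R :=
  match i with
  | 0 => fun=> 0
  | i1.+1 =>
    match i1 with
    | 0 => fun s => k (n - 1)%N s / k (n - 2)%N s
    | i2.+1 => fun s =>
        (k (n - (i + 1))%N s)^-1 *
        (k (n - i)%N s * harmonic_curvature n k i2 s
         - derive1 (harmonic_curvature n k i1) s)
    end
  end.

(* Main.v *)
Require Import Defs.
From mathcomp Require Import all_boot all_order all_algebra.
From mathcomp Require Import all_classical all_reals all_analysis.
From mathcomp Require Import ring lra zify.
Import Order.TTheory GRing.Theory Num.Theory.
Import numFieldNormedType.Exports.
Local Open Scope classical_set_scope.
Local Open Scope ring_scope.

Set Implicit Arguments.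
Unset Strict Implicit.

(** Write H_0 = 0, H_1, ..., H_(n-2) for the harmonic curvatures and let
    b_n = 1 and b_i = H_(n-1-i) for i < n.  The recursion defining the H_i says
    exactly that, for 2 <= i <= n, the b_i satisfy the equations
      b_i' = k_i b_(i+1) - k_(i-1) b_(i-1)
    obeyed by the coordinates <V_i, X> of a constant vector X in the Frenet
    frame; only the equation i = 1 may fail, and its defect is
    D = b_1' - k_1 b_2.  Two families c, d solving this system up to defects
    D_c, D_d satisfy (sum_i c_i d_i)' = D_c d_1 + c_1 D_d, because the matrix of
    the system is antisymmetric ([frenet_system_pairing]).

    If V_n makes a constant angle phi with X, solving the equations downwards
    from i = n gives <V_i, X> = b_i cos phi ([frenet_system_axis_coord]), and
    these coordinates have defect 0.  So the sum of their squares is constant,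
    and it equals cos^2 phi (1 + sum H_i^2).  If b_1 = H_(n-2) were identically
    zero, solving the equations upwards from i = 1 would make every coordinate
    vanish, including <V_n, X> = cos phi.

    Conversely, if sum H_i^2 is constant, then pairing b with itself gives
    D b_1 = 0, and it has to be deduced that D = 0 on all of I: then
    sum_i b_i V_i is a constant vector, and it serves as the axis after
    normalisation.  Since b_1 is only known not to vanish identically, this
    needs an argument.  Let U be the set where b_1 is nonzero, and W the
    complement in I of its closure.  On U the defect vanishes, and on W so does
    b_1.  If I is not contained in the closure of U, connectedness yields a
    point s0 of I adherent to both U and W.  The smooth functions on I that are
    sums of one vanishing on U and one vanishing on W form a differential ideal
    all of whose members vanish at s0.  It contains b_1 and D, hence, solving
    the equations upwards, also b_n = 1, which is absurd
    ([vanishing_split_system], [frenet_system_defect_eq0]).  Thus I is contained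
    in the closure of U, where D = 0 by continuity. *)

(** * Smooth functions on an open set *)

Lemma near_eq_open (R : realType) (T : Type) (I : set R) (f g : R -> T) (s : R) :
  open I -> (forall t, I t -> f t = g t) -> I s -> \near s, f s = g s.
Proof.
move=> oI fg Is; have := open_nbhs_nbhs (conj oI Is).
by apply: filterS => t /fg.
Qed.

Lemma derive1_eq_on (R : realType) (U : normedModType R) (I : set R)
    (f g : R -> U) (s : R) :
  open I -> (forall t, I t -> f t = g t) -> I s -> derive1 f s = derive1 g s.
Proof.
move=> oI fg Is; rewrite !derive1E; apply: near_eq_derive.
exact: near_eq_open fg Is.
Qed.

Lemma derivable_eq_on (R : realType) (U : normedModType R) (I : set R)
    (f g : R -> U) (s : R) :
  open I -> (forall t, I t -> f t = g t) -> I s ->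
  derivable f s 1 -> derivable g s 1.
Proof.
move=> oI fg Is df; apply: near_eq_derivable df.
exact: near_eq_open fg Is.
Qed.

Lemma is_derive_derive1 (R : realType) (U : normedModType R) (f : R -> U) (s : R) :
  derivable f s 1 -> is_derive s 1 f (derive1 f s).
Proof. by move=> df; apply: DeriveDef => //; rewrite derive1E. Qed.

Lemma is_derive_derive1E (R : realType) (U : normedModType R) (f : R -> U)
    (s : R) (df : U) :
  is_derive s 1 f df -> derive1 f s = df.
Proof. by move=> h; rewrite derive1E derive_val. Qed.

Lemma smooth_on_derivable (R : realType) (U : normedModType R) (I : set R)
    (f : R -> U) (s : R) : smooth_on I f -> I s -> derivable f s 1.
Proof. by move=> /(_ 0%N s) h /h. Qed.

Lemma smooth_on_derive1 (R : realType) (U : normedModType R) (I : set R)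
    (f : R -> U) : smooth_on I f -> smooth_on I (derive1 f).
Proof. by move=> h m s Is; have := h m.+1 s Is; rewrite derive1Sn. Qed.

(** Sums, products and inverses of smooth functions are treated together: this
    class is stable under derivation, which makes all its members smooth at once
    and replaces higher-order Leibniz formulas. *)
Inductive smooth_expr (R : realType) (I : set R) : (R -> R) -> Prop :=
| SmoothBase f : smooth_on I f -> smooth_expr I f
| SmoothCst a : smooth_expr I (fun=> a)
| SmoothAdd f g : smooth_expr I f -> smooth_expr I g ->
    smooth_expr I (fun s => f s + g s)
| SmoothMul f g : smooth_expr I f -> smooth_expr I g ->
    smooth_expr I (fun s => f s * g s)
| SmoothInv f : (forall s, I s -> f s != 0) -> smooth_expr I f ->
    smooth_expr I (fun s => (f s)^-1).

Lemma smooth_expr_derive (R : realType) (I : set R) (f : R -> R) :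
  smooth_expr I f ->
  exists2 df, smooth_expr I df & forall s, I s -> is_derive s 1 f (df s).
Proof.
elim=> {f} [f sf|a|f g _ [df edf fdf] _ [dg edg gdg]
           |f g ef [df edf fdf] eg [dg edg gdg]|f f0 ef [df edf fdf]].
- exists (derive1 f).
    exact/SmoothBase/smooth_on_derive1.
  move=> s Is; apply: is_derive_derive1; exact: smooth_on_derivable Is.
- exists (fun=> 0); first exact: SmoothCst.
  move=> s _; exact: is_derive_cst.
- exists (fun s => df s + dg s); first exact: SmoothAdd.
  by move=> s Is; apply: is_deriveD; [exact: fdf|exact: gdg].
- exists (fun s => f s * dg s + g s * df s).
    by apply: SmoothAdd; apply: SmoothMul.
  by move=> s Is; apply: is_deriveM; [exact: fdf|exact: gdg].
- exists (fun s => (-1 * ((f s)^-1 * (f s)^-1)) * df s).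
    apply: SmoothMul => //; apply: SmoothMul; first exact: SmoothCst.
    by apply: SmoothMul; apply: SmoothInv.
  move=> s Is; have := is_deriveV (f0 s Is) (fdf s Is).
  by rewrite -exprVn expr2 mulN1r.
Qed.

(** By induction on the order of derivation; the function g equal to f on I is
    needed because the derivative of f is an expression only on I. *)
Lemma smooth_exprP (R : realType) (I : set R) (f g : R -> R) :
  open I -> smooth_expr I f -> (forall s, I s -> f s = g s) -> smooth_on I g.
Proof.
move=> oI ef fg m; elim: m f g ef fg => [|m IHm] f g ef fg s Is.
  have [df _ /(_ s Is)[fdf _]] := smooth_expr_derive ef.
  exact: (derivable_eq_on (I := I) (f := f)).
have [df edf fdf] := smooth_expr_derive ef.
rewrite derive1Sn; apply: (IHm df) => // t It.
rewrite -(derive1_eq_on (I := I) (f := f))//; apply/esym/is_derive_derive1E.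
exact: fdf.
Qed.

Lemma smooth_on_eq (R : realType) (I : set R) (f g : R -> R) :
  open I -> (forall s, I s -> f s = g s) -> smooth_on I f -> smooth_on I g.
Proof. by move=> oI fg sf; apply: smooth_exprP fg => //; exact: SmoothBase. Qed.

Lemma smooth_on_cst (R : realType) (I : set R) (a : R) :
  open I -> smooth_on I (fun=> a : R).
Proof. by move=> oI; apply: (smooth_exprP (f := fun=> a)) => //; exact: SmoothCst. Qed.

Lemma smooth_onD (R : realType) (I : set R) (f g : R -> R) :
  open I -> smooth_on I f -> smooth_on I g -> smooth_on I (fun s => f s + g s).
Proof.
move=> oI sf sg; apply: (smooth_exprP (f := fun s => f s + g s)) => //.
by apply: SmoothAdd; exact: SmoothBase.
Qed.

Lemma smooth_onM (R : realType) (I : set R) (f g : R -> R) :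
  open I -> smooth_on I f -> smooth_on I g -> smooth_on I (fun s => f s * g s).
Proof.
move=> oI sf sg; apply: (smooth_exprP (f := fun s => f s * g s)) => //.
by apply: SmoothMul; exact: SmoothBase.
Qed.

Lemma smooth_onV (R : realType) (I : set R) (f : R -> R) :
  open I -> (forall s, I s -> f s != 0) ->
  smooth_on I f -> smooth_on I (fun s => (f s)^-1).
Proof.
move=> oI f0 sf; apply: (smooth_exprP (f := fun s => (f s)^-1)) => //.
by apply: SmoothInv => //; exact: SmoothBase.
Qed.

Lemma smooth_onB (R : realType) (I : set R) (f g : R -> R) :
  open I -> smooth_on I f -> smooth_on I g -> smooth_on I (fun s => f s - g s).
Proof.
move=> oI sf sg.
apply: (smooth_on_eq (f := fun s => f s + -1 * g s)) => [//|s _|].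
  by rewrite mulN1r.
have smg : smooth_on I (fun s => -1 * g s).
  exact: (smooth_onM oI (smooth_on_cst (a := -1) oI) sg).
exact: (smooth_onD oI sf smg).
Qed.

Lemma smooth_on_sum (R : realType) (I : set R) (n : nat) (f : 'I_n -> R -> R) :
  open I -> (forall i, smooth_on I (f i)) ->
  smooth_on I (fun s => \sum_(i < n) f i s).
Proof.
move=> oI; elim: n f => [|n IHn] f sf.
  apply: (smooth_on_eq (f := fun=> 0)) => // [s _|]; first by rewrite big_ord0.
  exact: smooth_on_cst.
apply: (smooth_on_eq
  (f := fun s => \sum_(i < n) f (widen_ord (leqnSn n) i) s + f ord_max s)) => //.
  by move=> s _; rewrite big_ord_recr.
apply: (smooth_onD (f := fun s => \sum_(i < n) f (widen_ord (leqnSn n) i) s)) => //.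
by apply: (IHn (fun i => f (widen_ord (leqnSn n) i))) => i; exact: sf.
Qed.

Lemma derive1_coord (R : realType) (n : nat) (f : R -> 'rV[R]_n) (j : 'I_n) (s : R) :
  derivable f s 1 -> derive1 (fun t => f t 0 j) s = derive1 f s 0 j.
Proof. by move=> df; rewrite !derive1E (derive_mx df) mxE. Qed.

Lemma smooth_on_coord (R : realType) (n : nat) (I : set R) (f : R -> 'rV[R]_n)
    (j : 'I_n) :
  open I -> smooth_on I f -> smooth_on I (fun t => f t 0 j).
Proof.
move=> oI sf m s Is.
have coordn t : I t -> derive1n m (fun t => f t 0 j) t = derive1n m f t 0 j.
  elim: m t {s Is} => // m IHm t It.
  rewrite !derive1nS (derive1_eq_on (I := I) (g := fun u => derive1n m f u 0 j))//.
  by apply: derive1_coord; exact: sf.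
apply: (derivable_eq_on (I := I) (f := fun u => derive1n m f u 0 j)) => //.
  by move=> t /coordn.
by have /derivable_mxP := sf m s Is; exact.
Qed.

Lemma smooth_on_dot (R : realType) (n : nat) (I : set R) (f g : R -> 'rV[R]_n) :
  open I -> (forall j, smooth_on I (fun t => f t 0 j)) ->
  (forall j, smooth_on I (fun t => g t 0 j)) ->
  smooth_on I (fun s => dot (f s) (g s)).
Proof.
move=> oI sf sg.
apply: (smooth_on_sum oI (f := fun j s => f s 0 j * g s 0 j)) => j.
exact: (smooth_onM oI (sf j) (sg j)).
Qed.

Lemma is_derive_sum_nat (R : realType) (m n : nat) (f : nat -> R -> R)
    (df : nat -> R) (s : R) :
  (forall i, (m <= i < n)%N -> is_derive s 1 (f i) (df i)) ->
  is_derive s 1 (fun t => \sum_(m <= i < n) f i t) (\sum_(m <= i < n) df i).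
Proof.
move=> fdf; rewrite big_nat.
have -> : (fun t => \sum_(m <= i < n) f i t)
        = \sum_(m <= i < n | (m <= i < n)%N) f i.
  by apply/funext => t; rewrite fct_sumE big_nat.
by elim/big_ind2 : _ => // [|*]; [exact: is_derive_cst|exact: is_deriveD].
Qed.

Lemma is_derive_dotl (R : realType) (n : nat) (f : R -> 'rV[R]_n)
    (X : 'rV[R]_n) (s : R) :
  derivable f s 1 ->
  is_derive s 1 (fun t => dot (f t) X) (dot (derive1 f s) X).
Proof.
move=> df; rewrite /dot.
have -> : (fun t => \sum_(j < n) f t 0 j * X 0 j)
        = \sum_(j < n) (fun t => f t 0 j * X 0 j).
  by apply/funext => t; rewrite fct_sumE.
apply: is_derive_sum => j.
have -> : (fun t => f t 0 j * X 0 j) = X 0 j \*: (fun t => f t 0 j).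
  by apply/funext => t; rewrite mulrC.
rewrite -derive1_coord// mulrC; apply: is_deriveZ.
apply: is_derive_derive1; by have /derivable_mxP := df; exact.
Qed.

Lemma is_derive0_constant_on (R : realType) (I : set R) (f : R -> R) :
  is_interval I -> (forall s, I s -> is_derive s 1 f 0) ->
  forall s t, I s -> I t -> f s = f t.
Proof.
move=> iI f0 s t; wlog st : s t / s <= t.
  by move=> h Is It; case/orP: (le_total s t) => [|/h h'];
    [move/h; exact | apply/esym/h'].
move=> Is It.
have inI x : x \in `[s, t] -> I x by rewrite in_itv/= => /(iI s t Is It).
have /MVT_segment : forall x, x \in `]s, t[ -> is_derive x 1 f ((fun=> 0) x).
  by move=> x xst; apply/f0/inI; exact: subset_itv_oo_cc.
case/(_ st) => [|c _ /eqP]; last by rewrite mul0r subr_eq0 => /eqP.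
apply: derivable_within_continuous => x /inI Ix.
by case: (f0 x Ix).
Qed.

Lemma continuous_eq0_closure (R : realType) (U : set R) (f : R -> R) (s : R) :
  {for s, continuous f} -> (forall t, U t -> f t = 0) -> closure U s -> f s = 0.
Proof.
move=> cf f0 clU; apply/eqP/negP => /negP fs0.
have /clU[t [Ut]] : \forall t \near s, f t != 0.
  apply: (cf [set x | x != 0]).
  by apply: open_nbhs_nbhs; split => //; exact: open_neq.
by rewrite /= f0 ?eqxx.
Qed.

Lemma smooth_on_continuous (R : realType) (I : set R) (f : R -> R) (s : R) :
  smooth_on I f -> I s -> {for s, continuous f}.
Proof.
move=> sf Is; apply: differentiable_continuous; apply/derivable1_diffP.
exact: smooth_on_derivable Is.
Qed.

(** * Frenet systems *)

(** With zero outside 1, ..., n - 1, the first and last Frenet formulas become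
    instances of the middle one, whatever stands for the missing neighbours. *)
Definition ext_curv (R : realType) (n : nat) (k : nat -> R -> R) (i : nat) :
    R -> R :=
  if (0 < i < n)%N then k i else fun=> 0.

(** The defect D is what separates the coordinates of a moving vector from those
    of a constant one: if the first equation fails by D, the vector moves with
    velocity D times the tangent. *)
Definition frenet_system (R : realType) (I : set R) (n : nat)
    (k : nat -> R -> R) (c : nat -> R -> R) (D : R -> R) : Prop :=
  forall i s, (1 <= i <= n)%N -> I s ->
    is_derive s 1 (c i)
      (ext_curv n k i s * c i.+1 s - ext_curv n k i.-1 s * c i.-1 s
       + (i == 1)%:R * D s).

Lemma ext_curv0 (R : realType) (n : nat) (k : nat -> R -> R) (s : R) :
  ext_curv n k 0 s = 0.
Proof. by []. Qed.

Lemma ext_curvn (R : realType) (n : nat) (k : nat -> R -> R) (s : R) :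
  ext_curv n k n s = 0.
Proof. by rewrite /ext_curv ltnn andbF. Qed.

Lemma ext_curvE (R : realType) (n : nat) (k : nat -> R -> R) (i : nat) :
  (0 < i < n)%N -> ext_curv n k i = k i.
Proof. by rewrite /ext_curv => ->. Qed.

(** The antisymmetry of the system makes the derivative of the pairing telescope:
    up to the defects, its i-th term is T i - T (i - 1), and T vanishes at both
    ends since the extended curvature does. *)
Lemma frenet_system_pairing (R : realType) (I : set R) (n : nat)
    (k b c : nat -> R -> R) (Db Dc : R -> R) (s : R) :
  (0 < n)%N -> frenet_system I n k b Db -> frenet_system I n k c Dc -> I s ->
  is_derive s 1 (fun t => \sum_(1 <= i < n.+1) b i t * c i t)
    (Db s * c 1%N s + b 1%N s * Dc s).
Proof.
move=> n0 sb sc Is.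
pose T i := ext_curv n k i s * (b i.+1 s * c i s + b i s * c i.+1 s).
have -> : Db s * c 1%N s + b 1%N s * Dc s
    = \sum_(1 <= i < n.+1) (T i - T i.-1
        + (i == 1)%:R * (Db s * c 1%N s + b 1%N s * Dc s)).
  rewrite big_split/= [X in _ = _ + X]big_ltn// eqxx mul1r.
  rewrite [X in _ = _ + (_ + X)](_ : _ = 0) ?addr0; last first.
    rewrite big_nat big1// => i /andP[i1 _].
    by rewrite gtn_eqF// mul0r.
  by rewrite big_add1/= telescope_sumr// /T ext_curv0 ext_curvn !mul0r subrr add0r.
apply: is_derive_sum_nat => i /andP[i1 iltn].
have iin : (1 <= i <= n)%N by rewrite i1 -ltnS.
apply: is_derive_eq; first by apply: is_deriveM; [exact: sb|exact: sc].
rewrite /T; case: i i1 {iltn iin} => // i _ /=.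
rewrite /GRing.scale/= eqSS; case: eqP => [->|_]; rewrite /= ?mulr1n ?mulr0n; ring.
Qed.

(** * A differential ideal attached to two open sets *)

(** For smooth f and open U, W inside I, this implies that f and all its
    derivatives vanish at the points of I adherent to both U and W.  Unlike flatness
    at a point, it is stable under products and derivation for trivial reasons. *)
Definition vanishing_split (R : realType) (I U W : set R) (f : R -> R) : Prop :=
  exists g h : R -> R, [/\ smooth_on I g, smooth_on I h,
    forall t, U t -> g t = 0, forall t, W t -> h t = 0 &
    forall t, I t -> f t = g t + h t].

Lemma vanishing_split_eq0 (R : realType) (I U W : set R) (f : R -> R) (s : R) :
  vanishing_split I U W f -> I s -> closure U s -> closure W s -> f s = 0.
Proof.
move=> [g [h [sg sh gU hW fE]]] Is clU clW.
have gs : {for s, continuous g} := smooth_on_continuous sg Is.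
have hs : {for s, continuous h} := smooth_on_continuous sh Is.
rewrite fE// (continuous_eq0_closure gs gU clU).
by rewrite (continuous_eq0_closure hs hW clW) addr0.
Qed.

Lemma vanishing_split_eq (R : realType) (I U W : set R) (f f' : R -> R) :
  (forall t, I t -> f t = f' t) ->
  vanishing_split I U W f -> vanishing_split I U W f'.
Proof.
move=> ff' [g [h [sg sh gU hW E]]].
by exists g, h; split => // t It; rewrite -ff'// E.
Qed.

Lemma vanishing_splitl (R : realType) (I U W : set R) (f : R -> R) :
  open I -> smooth_on I f -> (forall t, U t -> f t = 0) ->
  vanishing_split I U W f.
Proof.
move=> oI sf fU; exists f, (fun=> 0).
split; [exact: sf|exact: smooth_on_cst|exact: fU|by []|].
by move=> t _; rewrite addr0.
Qed.

Lemma vanishing_splitr (R : realType) (I U W : set R) (f : R -> R) :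
  open I -> smooth_on I f -> (forall t, W t -> f t = 0) ->
  vanishing_split I U W f.
Proof.
move=> oI sf fW; exists (fun=> 0), f.
split; [exact: smooth_on_cst|exact: sf|by []|exact: fW|].
by move=> t _; rewrite add0r.
Qed.

Lemma vanishing_splitD (R : realType) (I U W : set R) (f1 f2 : R -> R) :
  open I -> vanishing_split I U W f1 -> vanishing_split I U W f2 ->
  vanishing_split I U W (fun t => f1 t + f2 t).
Proof.
move=> oI [g1 [h1 [sg1 sh1 gU1 hW1 E1]]] [g2 [h2 [sg2 sh2 gU2 hW2 E2]]].
exists (fun t => g1 t + g2 t), (fun t => h1 t + h2 t); split.
- exact: (smooth_onD oI sg1 sg2).
- exact: (smooth_onD oI sh1 sh2).
- by move=> t Ut; rewrite gU1// gU2// addr0.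
- by move=> t Wt; rewrite hW1// hW2// addr0.
- by move=> t It; rewrite E1// E2// addrACA.
Qed.

Lemma vanishing_splitM (R : realType) (I U W : set R) (a f : R -> R) :
  open I -> smooth_on I a -> vanishing_split I U W f ->
  vanishing_split I U W (fun t => a t * f t).
Proof.
move=> oI sa [g [h [sg sh gU hW E]]].
exists (fun t => a t * g t), (fun t => a t * h t); split.
- exact: (smooth_onM oI sa sg).
- exact: (smooth_onM oI sa sh).
- by move=> t Ut; rewrite gU// mulr0.
- by move=> t Wt; rewrite hW// mulr0.
- by move=> t It; rewrite E// mulrDr.
Qed.

Lemma vanishing_split_derive1 (R : realType) (I U W : set R) (f : R -> R) :
  open I -> open U -> open W ->
  vanishing_split I U W f -> vanishing_split I U W (derive1 f).
Proof.
move=> oI oU oW [g [h [sg sh gU hW E]]].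
exists (derive1 g), (derive1 h); split.
- exact: smooth_on_derive1.
- exact: smooth_on_derive1.
- move=> t Ut; rewrite (derive1_eq_on (I := U) (g := fun=> 0))//.
  exact: derive1_cst.
- move=> t Wt; rewrite (derive1_eq_on (I := W) (g := fun=> 0))//.
  exact: derive1_cst.
- move=> t It; rewrite (derive1_eq_on (I := I) (g := fun u => g u + h u))//.
  apply: is_derive_derive1E.
  by apply: is_deriveD; apply: is_derive_derive1; exact: smooth_on_derivable It.
Qed.

(** Since the curvatures are invertible, each equation expresses c_(i+1) through
    c_i', c_(i-1) and the defect, so that membership in the ideal climbs from
    c_1 to c_n. *)
Lemma vanishing_split_system (R : realType) (I U W : set R) (n : nat)
    (k c : nat -> R -> R) (D : R -> R) :
  open I -> open U -> open W -> (0 < n)%N ->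
  (forall i, smooth_on I (ext_curv n k i)) ->
  (forall i t, (0 < i < n)%N -> I t -> ext_curv n k i t != 0) ->
  frenet_system I n k c D ->
  vanishing_split I U W (c 1%N) -> vanishing_split I U W D ->
  vanishing_split I U W (c n).
Proof.
move=> oI oU oW n0 sk k0 sys P1 PD.
(* The second component has the weight of the extended curvature so that it holds
   at i = 0, where nothing is known of c 0. *)
suff Pc i : (i < n)%N -> vanishing_split I U W (c i.+1) /\
    vanishing_split I U W (fun t => ext_curv n k i t * c i t).
  by case: n n0 {sk k0 sys} Pc => // n _ /(_ n (ltnSn n))[].
elim: i => [_|i IHi ilt].
  split=> //; apply: (@vanishing_split_eq _ _ _ _ (fun t => (fun=> 0) t * D t)).
    by move=> t _; rewrite ext_curv0 !mul0r.
  by apply: vanishing_splitM => //; exact: smooth_on_cst.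
have [Pc Pc'] := IHi (ltnW ilt).
split; last exact: vanishing_splitM.
have sV : smooth_on I (fun t => (ext_curv n k i.+1 t)^-1).
  by apply: (smooth_onV oI _ (sk _)) => t It; exact: k0.
apply: (@vanishing_split_eq _ _ _ _ (fun t => (ext_curv n k i.+1 t)^-1 *
  ((derive1 (c i.+1) t + ext_curv n k i t * c i t)
   + (- (i == 0)%:R) * D t))).
  move=> t It; have /is_derive_derive1E -> := sys i.+1 t (ltnW ilt) It.
  apply: (mulfI (k0 i.+1 t _ It)); first by [].
  by rewrite mulVKf ?k0// eqSS /=; ring.
have Pder := vanishing_split_derive1 oI oU oW Pc.
have PD' := vanishing_splitM oI (smooth_on_cst (a := - (i == 0)%:R) oI) PD.
exact: (vanishing_splitM oI sV
  (vanishing_splitD oI (vanishing_splitD oI Pder Pc') PD')).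
Qed.

(** * Frenet frames as Frenet systems *)
Lemma dot_sumr (R : realType) (n : nat) (m p : nat) (u : 'rV[R]_n)
    (b : nat -> R) (v : nat -> 'rV[R]_n) :
  dot u (\sum_(m <= i < p) b i *: v i) = \sum_(m <= i < p) b i * dot (v i) u.
Proof.
rewrite /dot.
under eq_bigr do rewrite summxE big_distrr/=.
rewrite exchange_big/=; apply: eq_bigr => i _.
rewrite big_distrr/=; apply: eq_bigr => j _; rewrite mxE; ring.
Qed.

Lemma dotDl (R : realType) (n : nat) (a b : R) (u v w : 'rV[R]_n) :
  dot (a *: u + b *: v) w = a * dot u w + b * dot v w.
Proof.
rewrite /dot !big_distrr -big_split/=; apply: eq_bigr => j _.
by rewrite !mxE; ring.
Qed.

Lemma dotC (R : realType) (n : nat) (u v : 'rV[R]_n) : dot u v = dot v u.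
Proof. by apply: eq_bigr => j _; rewrite mulrC. Qed.

Lemma dotZr (R : realType) (n : nat) (a : R) (u v : 'rV[R]_n) :
  dot u (a *: v) = a * dot u v.
Proof.
rewrite /dot big_distrr/=; apply: eq_bigr => j _.
by rewrite !mxE; ring.
Qed.

Lemma frenet_frame_derive (R : realType) (n : nat) (I : set R)
    (alpha : R -> 'rV[R]_n) (V : nat -> R -> 'rV[R]_n) (k : nat -> R -> R)
    (i : nat) (s : R) :
  (1 < n)%N -> frenet_frame I alpha V k -> (1 <= i <= n)%N -> I s ->
  derive1 (V i) s = ext_curv n k i s *: V i.+1 s + (- ext_curv n k i.-1 s) *: V i.-1 s.
Proof.
move=> n1 F /andP[i1 iln] Is.
have [->|i_neq1] := eqVneq i 1%N.
  by rewrite (frenet_first F)// ext_curvE// ext_curv0 oppr0 scale0r addr0.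
have [->|i_neqn] := eqVneq i n.
  rewrite (frenet_last F)// ext_curvn scale0r add0r ext_curvE ?subn1//; lia.
by rewrite (frenet_mid F) ?ext_curvE ?subn1 ?addn1 1?addrC//; lia.
Qed.

Lemma frenet_frame_system (R : realType) (n : nat) (I : set R)
    (alpha : R -> 'rV[R]_n) (V : nat -> R -> 'rV[R]_n) (k : nat -> R -> R)
    (X : 'rV[R]_n) :
  (1 < n)%N -> frenet_frame I alpha V k ->
  frenet_system I n k (fun i s => dot (V i s) X) (fun=> 0).
Proof.
move=> n1 F i s iin Is.
have dV : derivable (V i) s 1 := smooth_on_derivable (frenet_smooth F iin) Is.
apply: is_derive_eq; first exact: (is_derive_dotl X dV).
by rewrite (frenet_frame_derive n1 F iin Is) dotDl mulr0 addr0 mulNr.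
Qed.

(** The curvature k_i is smooth on I because it equals the inner product of V_i'
    with V_(i+1) there. *)
Lemma smooth_on_ext_curv (R : realType) (n : nat) (I : set R)
    (alpha : R -> 'rV[R]_n) (V : nat -> R -> 'rV[R]_n) (k : nat -> R -> R)
    (i : nat) :
  open I -> (1 < n)%N -> frenet_frame I alpha V k -> smooth_on I (ext_curv n k i).
Proof.
move=> oI n1 F; have [/andP[i0 iltn]|iout] := boolP (0 < i < n)%N; last first.
  by rewrite /ext_curv (negbTE iout); exact: smooth_on_cst.
have iin : (1 <= i <= n)%N by rewrite i0 ltnW.
have i1in : (1 <= i.+1 <= n)%N by [].
have sdV j : smooth_on I (fun t => derive1 (V i) t 0 j).
  apply: (smooth_on_coord (f := derive1 (V i))) => //.
  exact/smooth_on_derive1/(frenet_smooth F).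
have sV j : smooth_on I (fun t => V i.+1 t 0 j).
  by apply: (smooth_on_coord (f := V i.+1)) => //; exact: (frenet_smooth F).
apply: (smooth_on_eq oI _ (smooth_on_dot oI sdV sV)) => s Is.
rewrite (frenet_frame_derive n1 F iin Is) dotDl (frenet_orthonormal F)// eqxx.
have [i_eq1|i_neq1] := eqVneq i 1%N.
  have -> : ext_curv n k i.-1 s = 0 by rewrite i_eq1 ext_curv0.
  by rewrite mulr1 oppr0 mul0r addr0.
rewrite (frenet_orthonormal F)//; last lia.
by rewrite (_ : i.-1 == i.+1 = false); [rewrite mulr1 mulr0 addr0|lia].
Qed.

(** * Harmonic curvatures as coordinates of an axis *)

(** In the Frenet frame these are the coordinates, up to a common factor, that a
    slant helix forces on its axis; the value at n is normalised to 1. *)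
Definition axis_coord (R : realType) (n : nat) (k : nat -> R -> R) (i : nat) :
    R -> R :=
  if i == n then fun=> 1 else harmonic_curvature n k (n - i).-1.

Lemma axis_coord_n (R : realType) (n : nat) (k : nat -> R -> R) (s : R) :
  axis_coord n k n s = 1.
Proof. by rewrite /axis_coord eqxx. Qed.

(** The recursion of the harmonic curvatures, run downwards in i.  The cases
    i = n and i = n - 1 recover H_0 = 0 and H_1 = k_(n-1) / k_(n-2) because
    the extended curvature vanishes at n and the coordinate at n is 1. *)
Lemma axis_coord_rec (R : realType) (n : nat) (k : nat -> R -> R) (i : nat) (s : R) :
  (1 < i <= n)%N ->
  axis_coord n k i.-1 s = (ext_curv n k i.-1 s)^-1 *
    (ext_curv n k i s * axis_coord n k i.+1 s - derive1 (axis_coord n k i) s).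
Proof.
move=> /andP[i1 iln].
have [->|i_neqn] := eqVneq i n.
  rewrite ext_curvn mul0r /axis_coord eqxx derive1_cst subrr mulr0.
  rewrite ifF; last lia.
  by rewrite (_ : (n - n.-1).-1 = 0)%N//; lia.
have [i_eq|i_neq] := eqVneq i.+1 n.
  rewrite i_eq axis_coord_n /axis_coord !ifF; [|lia..].
  have -> : (n - i.-1).-1 = 1%N by lia.
  have -> : (n - i).-1 = 0%N by lia.
  have -> : derive1 (harmonic_curvature n k 0) s = 0 by exact: derive1_cst.
  rewrite mulr1 subr0 [RHS]mulrC /=.
  by rewrite !ext_curvE; [congr (k _ _ / k _ _); lia|lia..].
rewrite /axis_coord !ifF; [|lia..].
have [m mE] : exists m, (n - i.+1).-1 = m by eexists.
have -> : (n - i.-1).-1 = m.+2 by lia.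
have -> : (n - i).-1 = m.+1 by lia.
rewrite mE [LHS]/= !ext_curvE; [|lia..].
by congr ((k _ _)^-1 * (k _ _ * _ - _)); lia.
Qed.

Lemma smooth_on_axis_coord (R : realType) (n : nat) (I : set R)
    (k : nat -> R -> R) (i : nat) :
  open I -> (forall i, smooth_on I (ext_curv n k i)) ->
  (forall i t, (0 < i < n)%N -> I t -> ext_curv n k i t != 0) ->
  (0 < i)%N -> smooth_on I (axis_coord n k i).
Proof.
move=> oI sk k0 i0.
have [iltn|] := ltnP n i.
  rewrite /axis_coord ifF; last lia.
  by rewrite (_ : (n - i).-1 = 0%N); [exact: smooth_on_cst|lia].
move=> iln; pose j := (n - i)%N.
suff H : (j < n)%N -> smooth_on I (axis_coord n k (n - j)) /\
    smooth_on I (axis_coord n k (n - j).+1).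
  have jn : (j < n)%N by rewrite /j; lia.
  have <- : (n - j)%N = i by rewrite /j; lia.
  exact: (H jn).1.
elim: j => [_|j IHj jn].
  rewrite subn0; split; rewrite /axis_coord.
    by rewrite eqxx; exact: smooth_on_cst.
  rewrite ifF; last lia.
  by rewrite (_ : (n - n.+1).-1 = 0%N); [exact: smooth_on_cst|lia].
have [sj sj1] := IHj (ltnW jn).
have -> : (n - j.+1).+1 = (n - j)%N by lia.
split; last exact: sj.
rewrite subnS.
have kV : smooth_on I (fun t => (ext_curv n k (n - j).-1 t)^-1).
  apply: (smooth_onV oI _ (sk _)) => t It; apply: k0 => //; lia.
apply: (smooth_on_eq oI _ (smooth_onM oI kV (smooth_onB oI
  (smooth_onM oI (sk (n - j)%N) sj1) (smooth_on_derive1 sj)))) => t It.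
by rewrite axis_coord_rec//; lia.
Qed.

Lemma axis_coord_system (R : realType) (n : nat) (I : set R)
    (k : nat -> R -> R) :
  open I -> (forall i, smooth_on I (ext_curv n k i)) ->
  (forall i t, (0 < i < n)%N -> I t -> ext_curv n k i t != 0) ->
  frenet_system I n k (axis_coord n k)
    (fun s => derive1 (axis_coord n k 1) s - ext_curv n k 1 s * axis_coord n k 2 s).
Proof.
move=> oI sk k0 i s /andP[i1 iln] Is.
have db : derivable (axis_coord n k i) s 1.
  by apply: smooth_on_derivable Is; exact: smooth_on_axis_coord.
apply: is_derive_eq; first exact: is_derive_derive1.
have [->|i_neq1] := eqVneq i 1%N.
  rewrite ext_curv0 /= mulr1n; ring.
rewrite (@axis_coord_rec _ n k i s); last lia.
rewrite mulVKf; last by apply: k0 => //; lia.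
by rewrite /= mulr0n; ring.
Qed.

Lemma sum_axis_coord_sqr (R : realType) (n : nat) (k : nat -> R -> R) (s : R) :
  (1 < n)%N ->
  \sum_(1 <= i < n.+1) axis_coord n k i s * axis_coord n k i s
  = 1 + \sum_(1 <= i < (n - 2).+1) (harmonic_curvature n k i s) ^+ 2.
Proof.
case: n => // [[]] // m _.
have -> : (m.+2 - 2)%N = m by lia.
rewrite big_nat_recr// big_nat_recr// axis_coord_n mulr1 addrC; congr (_ + _).
rewrite [X in _ _ X = _](_ : _ = 0); last first.
  by rewrite /axis_coord ifF ?subSnn ?mulr0//; lia.
rewrite [LHS]addr0 big_nat_rev/=; apply: eq_big_nat => i /andP[i1 im].
rewrite /axis_coord ifF -?expr2; last lia.
by congr (harmonic_curvature _ _ _ _ ^+ 2); lia.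
Qed.

(** * Vanishing of the defect *)

(** The trace of the closure of U on I is relatively closed; the hypothesis says
    that it is also relatively open, being the complement of the closure of the
    rest of I. *)
Lemma interval_sub_closure (R : realType) (I U : set R) :
  is_interval I -> U `<=` I -> U !=set0 ->
  (forall s, I s -> closure U s -> closure (I `\` closure U) s -> False) ->
  I `<=` closure U.
Proof.
move=> /connected_intervalP cI UI [u Uu] disj.
suff <- : I `&` closure U = I by move=> s [].
apply: cI.
- by exists u; split; [exact: UI|exact: subset_closure].
- exists (~` closure (I `\` closure U)).
    exact/closed_openC/closed_closure.
  apply/seteqP; split => s [Is].
    by move=> cUs; split=> // /(disj s Is cUs).
  move=> ncl; split=> //; apply: contrapT => nU; apply: ncl.
  exact: subset_closure.
- by exists (closure U) => //; exact: closed_closure.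
Qed.

(** The equation D c_1 = 0 gives D = 0 only where c_1 is nonzero.  If c_1 vanished on a
    nonempty open subset of I, this subset could be taken with an end in I that is
    also adherent to the set where c_1 is nonzero, and
    [vanishing_split_system] would make c_n vanish at this end. *)
Lemma frenet_system_defect_eq0 (R : realType) (I : set R) (n : nat)
    (k c : nat -> R -> R) (D : R -> R) :
  open I -> is_interval I -> (0 < n)%N ->
  (forall i, smooth_on I (ext_curv n k i)) ->
  (forall i t, (0 < i < n)%N -> I t -> ext_curv n k i t != 0) ->
  smooth_on I (c 1%N) -> smooth_on I D -> frenet_system I n k c D ->
  (forall t, I t -> c n t != 0) ->
  (forall t, I t -> D t * c 1%N t = 0) ->
  ~ (forall t, I t -> c 1%N t = 0) ->
  forall t, I t -> D t = 0.
Proof.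
move=> oI iI n0 sk k0 sc sD sys cn Dc nc.
pose U := I `&` [set t | c 1%N t != 0].
have oU : open U.
  rewrite openE => t [It ct]; apply: filterI.
    exact: open_nbhs_nbhs.
  have cc : {for t, continuous (c 1%N)} := smooth_on_continuous sc It.
  have : nbhs (c 1%N t) [set x | x != 0].
    by apply: open_nbhs_nbhs; split => //; exact: open_neq.
  by move=> /cc.
have DU t : U t -> D t = 0.
  by move=> [It ct]; have /eqP := Dc t It; rewrite mulf_eq0 (negbTE ct) orbF => /eqP.
pose W := I `\` closure U.
have oW : open W.
  by apply: openI => //; exact/closed_openC/closed_closure.
have cW t : W t -> c 1%N t = 0.
  move=> [It nU]; apply/eqP/negP => /negP ct; apply: nU.
  exact: subset_closure.
have IU : I `<=` closure U.
  apply: interval_sub_closure => //; first by move=> t [].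
    apply: contrapT => U0; apply: nc => t It; apply/eqP/negP => /negP ct.
    by apply: U0; exists t.
  move=> s Is clU clW.
  have P1 : vanishing_split I U W (c 1%N) := vanishing_splitr U oI sc cW.
  have PD : vanishing_split I U W D := vanishing_splitl W oI sD DU.
  have Pn := vanishing_split_system oI oU oW n0 sk k0 sys P1 PD.
  by have := cn s Is; rewrite (vanishing_split_eq0 Pn Is clU clW) eqxx.
move=> t It; apply: (continuous_eq0_closure _ DU (IU t It)).
exact: smooth_on_continuous It.
Qed.

(** * Slant helices *)

(** Solving the system downwards from i = n: the equations of index at least 2
    determine each coordinate from the two above it, and multiplying the coordinate
    of index n by a constant multiplies all the others by it. *)
Lemma frenet_system_axis_coord (R : realType) (I : set R) (n : nat)
    (k c : nat -> R -> R) (D : R -> R) (a : R) :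
  open I -> (forall i, smooth_on I (ext_curv n k i)) ->
  (forall i t, (0 < i < n)%N -> I t -> ext_curv n k i t != 0) ->
  frenet_system I n k c D -> (forall t, I t -> c n t = a) ->
  forall i t, (0 < i <= n)%N -> I t -> c i t = a * axis_coord n k i t.
Proof.
move=> oI sk k0 sys cn.
(* Weighting the upper neighbour by the extended curvature removes it from the
   claim at j = 0, where its index n + 1 is out of range. *)
suff H j : (j < n)%N -> forall t, I t ->
    c (n - j)%N t = a * axis_coord n k (n - j) t /\
    ext_curv n k (n - j) t * c (n - j).+1 t
      = a * (ext_curv n k (n - j) t * axis_coord n k (n - j).+1 t).
  move=> i t /andP[i0 iln] It.
  have jn : (n - i < n)%N by lia.
  have := (H _ jn t It).1.
  by rewrite subKn.
elim: j => [_ t It|j IHj jn t It].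
  by rewrite subn0 ext_curvn !mul0r mulr0 axis_coord_n mulr1 cn.
have ni : ((n - j.+1).+1 = n - j)%N by lia.
have IH := IHj (ltnW jn).
rewrite ni; split; last by rewrite (IH t It).1; ring.
have i1 : (1 < n - j <= n)%N by lia.
have /is_derive_derive1E dc := sys (n - j)%N t (ltac:(lia)) It.
have db : derivable (axis_coord n k (n - j)) t 1.
  by apply: smooth_on_derivable It; apply: (smooth_on_axis_coord oI sk k0); lia.
have : derive1 (c (n - j)%N) t = a * derive1 (axis_coord n k (n - j)) t.
  rewrite (derive1_eq_on (I := I) (g := a \*: axis_coord n k (n - j))) //.
    by apply: is_derive_derive1E; apply: is_deriveZ; exact: is_derive_derive1.
  by move=> u Iu; rewrite (IH u Iu).1.
rewrite dc (IH t It).2 gtn_eqF ?mul0r ?addr0; last lia.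
have -> : (n - j.+1)%N = (n - j).-1 by lia.
move=> E.
have kn : ext_curv n k (n - j).-1 t != 0 by apply: k0 => //; lia.
apply: (mulfI kn); rewrite (axis_coord_rec k t i1) mulrCA mulVKf//.
by rewrite mulrBr -E; ring.
Qed.

Definition axis (R : realType) (n : nat) (V : nat -> R -> 'rV[R]_n)
    (k : nat -> R -> R) (s : R) : 'rV[R]_n :=
  \sum_(1 <= i < n.+1) axis_coord n k i s *: V i s.

Lemma dot_frame_axis (R : realType) (n : nat) (I : set R)
    (alpha : R -> 'rV[R]_n) (V : nat -> R -> 'rV[R]_n) (k : nat -> R -> R)
    (i : nat) (s : R) :
  frenet_frame I alpha V k -> (1 <= i <= n)%N -> I s ->
  dot (V i s) (axis V k s) = axis_coord n k i s.
Proof.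
move=> F iin Is; rewrite dot_sumr (bigD1_seq i)/= ?iota_uniq//; last first.
  by rewrite mem_index_iota ltnS.
rewrite (frenet_orthonormal F)// eqxx mulr1 big_nat_cond big1 ?addr0//.
move=> j /andP[/andP[j1 jn] ji].
by rewrite (frenet_orthonormal F) ?(negbTE ji) ?mulr0 ?j1.
Qed.

Unset Implicit Arguments.
Set Strict Implicit.

Theorem theorem4p1 (R : realType) (n : nat) (hn : (3 <= n)%N)
    (I : set R) (hI : open_interval I)
    (alpha : R -> 'rV[R]_n) (halpha : smooth_on I alpha)
    (hunit : unit_speed I alpha)
    (V : nat -> R -> 'rV[R]_n) (k : nat -> R -> R)
    (hframe : frenet_frame I alpha V k)
    (hk : forall i s, (1 <= i <= n - 1)%N -> I s -> k i s != 0) :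
  Vn_slant_helix I V <->
  (exists c : R, forall s, I s ->
     \sum_(1 <= i < (n - 2).+1) (harmonic_curvature n k i s) ^+ 2 = c) /\
  ~ (forall s, I s -> harmonic_curvature n k (n - 2) s = 0).
Proof.
have [oI iI [s0 Is0]] := hI.
have n1 : (1 < n)%N by lia.
have n0 : (0 < n)%N by lia.
have sk i : smooth_on I (ext_curv n k i) := smooth_on_ext_curv oI n1 hframe.
have k0 i t : (0 < i < n)%N -> I t -> ext_curv n k i t != 0.
  by move=> iin It; rewrite ext_curvE//; apply: hk => //; lia.
have sysV X := frenet_frame_system X n1 hframe.
have b1E : axis_coord n k 1 = harmonic_curvature n k (n - 2).
  rewrite /axis_coord ifF; last lia.
  by rewrite (_ : (n - 1).-1 = n - 2)%N//; lia.
split.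
  move=> [X [phi [_ phi_in phi_neq VX]]].
  have cos0 : cos phi != 0.
    rewrite -(@cos_pihalf R); apply: contra phi_neq => /eqP cosE.
    apply/eqP; apply: cos_inj cosE; rewrite ?in_itv//=.
    by have := @pi_gt0 R; lra.
  have aE := frenet_system_axis_coord oI sk k0 (sysV X) VX.
  split.
    pose Q t := \sum_(1 <= i < n.+1) dot (V i t) X * dot (V i t) X.
    have Q_cst : forall s t, I s -> I t -> Q s = Q t.
      apply: (is_derive0_constant_on iI) => s Is.
      have := frenet_system_pairing n0 (sysV X) (sysV X) Is.
      by rewrite mul0r mulr0 addr0.
    have QE t : I t -> Q t = cos phi ^+ 2 * (1 +
        \sum_(1 <= i < (n - 2).+1) (harmonic_curvature n k i t) ^+ 2).
      move=> It; rewrite -sum_axis_coord_sqr// big_distrr/=.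
      apply: eq_big_nat => i iin.
      by rewrite (aE i t iin It); ring.
    exists (\sum_(1 <= i < (n - 2).+1) (harmonic_curvature n k i s0) ^+ 2).
    move=> s Is; have := Q_cst s s0 Is Is0; rewrite !QE//.
    by move=> /(mulfI (expf_neq0 2 cos0)) /addrI.
  move=> H0.
  (* With U = W = I the ideal consists of the functions vanishing on I. *)
  have P1 : vanishing_split I I I (fun t => dot (V 1%N t) X).
    apply: (@vanishing_split_eq _ _ _ _ (fun=> 0)).
      by move=> t It; rewrite (aE 1%N t n0 It) b1E H0// mulr0.
    by apply: vanishing_splitl => //; exact: smooth_on_cst.
  have PD : vanishing_split I I I (fun=> 0).
    by apply: vanishing_splitl => //; exact: smooth_on_cst.
  have Pn := vanishing_split_system oI oI oI n0 sk k0 (sysV X) P1 PD.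
  have cl0 := subset_closure Is0.
  have := vanishing_split_eq0 Pn Is0 cl0 cl0.
  by rewrite VX// => /eqP; rewrite (negbTE cos0).
move=> [[c Hc] Hn0].
set D := fun s : R =>
  derive1 (axis_coord n k 1) s - ext_curv n k 1 s * axis_coord n k 2 s.
have sysb : frenet_system I n k (axis_coord n k) D := axis_coord_system oI sk k0.
have sb i : (0 < i)%N -> smooth_on I (axis_coord n k i).
  exact: smooth_on_axis_coord.
have sD : smooth_on I D.
  apply: (smooth_onB oI (smooth_on_derive1 (sb 1%N isT))).
  exact: (smooth_onM oI (sk 1%N) (sb 2%N isT)).
have normE t : I t ->
    \sum_(1 <= i < n.+1) axis_coord n k i t * axis_coord n k i t = 1 + c.
  by move=> It; rewrite sum_axis_coord_sqr// Hc.
have Db1 t : I t -> D t * axis_coord n k 1 t = 0.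
  move=> It.
  have /is_derive_derive1E := frenet_system_pairing n0 sysb sysb It.
  rewrite (derive1_eq_on (I := I) (g := fun=> 1 + c))// derive1_cst.
  by rewrite [axis_coord _ _ _ _ * D t]mulrC; lra.
have D0 : forall t, I t -> D t = 0.
  apply: (frenet_system_defect_eq0 oI iI n0 sk k0 (sb 1%N isT) sD sysb _ Db1).
    by move=> t _; rewrite axis_coord_n oner_neq0.
  by rewrite b1E.
have axis_cst Y s : I s -> dot Y (axis V k s) = dot Y (axis V k s0).
  move=> Is; apply: (is_derive0_constant_on (f := fun u => dot Y (axis V k u))
    iI _ Is Is0) => t It.
  have -> : (fun u => dot Y (axis V k u)) =
      (fun u => \sum_(1 <= i < n.+1) axis_coord n k i u * dot (V i u) Y).
    by apply/funext => u; rewrite dot_sumr.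
  have := frenet_system_pairing n0 sysb (sysV Y) It.
  by rewrite D0// mul0r mulr0 addr0.
have norm_axis : dot (axis V k s0) (axis V k s0) = 1 + c.
  rewrite dot_sumr -(normE s0 Is0); apply: eq_big_nat => i iin.
  by rewrite (dot_frame_axis hframe iin Is0).
have c_ge0 : 0 <= c.
  by rewrite -(Hc s0 Is0); apply: sumr_ge0 => i _; exact: sqr_ge0.
pose r := Num.sqrt (1 + c).
have r2 : r ^+ 2 = 1 + c by rewrite sqr_sqrtr//; lra.
have r0 : 0 < r by rewrite sqrtr_gt0; lra.
have r1 : 1 <= r by rewrite -sqrtr1 ler_sqrt; lra.
have rV_gt0 : 0 < r^-1 by rewrite invr_gt0.
have rV_le1 : r^-1 <= 1 by rewrite invf_le1.
have rV_in : -1 <= r^-1 <= 1 by lra.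
have cosE : cos (acos r^-1) = r^-1 by apply: acosK; rewrite in_itv.
exists (r^-1 *: axis V k s0), (acos r^-1); split.
- rewrite dotZr dotC dotZr norm_axis -r2.
  by field; rewrite gt_eqF.
- by rewrite acos_ge0// acos_lepi.
- apply/eqP => acosE; move: rV_gt0; rewrite -cosE acosE cos_pihalf ltxx.
  by [].
- move=> s Is; rewrite cosE dotZr -(axis_cst _ s Is).
  rewrite (dot_frame_axis hframe _ Is) ?axis_coord_n ?mulr1//.
  by rewrite n0 leqnn.
Qed.
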